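(* Let $n\ge 1$ and $\alpha_1,\dots,\alpha_n\in F$. Every trace identity of $D_{n+1}^{t_{\alpha_1,\dots,\alpha_n,0}}$ follows from the commutator $[x_1,x_2]$ and from pure trace identities; that is, the $T^{tr}$-ideal $\mathrm{Id}^{tr}\big(D_{n+1}^{t_{\alpha_1,\dots,\alpha_n,0}}\big)$ is generated, as a $T^{tr}$-ideal, by $[x_1,x_2]$ together with all pure trace polynomials that are trace identities of $D_{n+1}^{t_{\alpha_1,\dots,\alpha_n,0}}$.
   Context: $F$ is a field of characteristic zero; all algebras are associative, unitary, over $F$. An algebra with trace is an algebra $A$ with a linear map $\mathrm{tr}\colon A\to F$ such that $\mathrm{tr}(ab)=\mathrm{tr}(ba)$ for all $a,b\in A$; $F$ is identified with $F\cdot 1_A\subseteq A$. Let $X=\{x_1,x_2,\dots\}$ and let $\mathcal M$ be the set of (nonempty) monomials in the noncommuting variables of $X$. The free algebra with trace is $F\langle X,\mathrm{Tr}\rangle\cong F\langle X\rangle\otimes F[\mathrm{Tr}(M)\mid M\in\mathcal M]$, where the $\mathrm{Tr}(M)$ are central commuting variables subject to $\mathrm{Tr}(MN)=\mathrm{Tr}(NM)$ and $\mathrm{Tr}(\mathrm{Tr}(M)N)=\mathrm{Tr}(M)\mathrm{Tr}(N)$. Its elements are called trace polynomials; the symbol $\mathrm{Tr}(1)$ does not occur. A trace polynomial is pure if all its variables appear inside traces. A trace polynomial $f(x_1,\dots,x_n,\mathrm{Tr})$ is a trace identity of $A$ if it vanishes whenever the $x_i$ are replaced by arbitrary elements of $A$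 and $\mathrm{Tr}$ by $\mathrm{tr}$. $\mathrm{Id}^{tr}(A)$ is the set of all trace identities of $A$. A $T^{tr}$-ideal is an ideal of $F\langle X,\mathrm{Tr}\rangle$ invariant under all endomorphisms (substitutions of the variables by linear combinations, with coefficients in $F[\mathrm{Tr}(M)\mid M\in\mathcal M]$, of nonempty monomials, compatibly with $\mathrm{Tr}$) and closed under taking traces ($f\mapsto \mathrm{Tr}(fM)$ for $M\in\mathcal M$, and $f\mapsto\mathrm{Tr}(f)$ when $f$ has no pure trace term). The $T^{tr}$-ideal generated by a set is the smallest one containing it, and its elements are called consequences of the set. $[x_1,x_2]=x_1x_2-x_2x_1$. $D_n$ is the algebra of $n\times n$ diagonal matrices over $F$, and $D_n^{t_{\alpha_1,\dots,\alpha_n}}$ is $D_n$ with the trace $t_{\alpha_1,\dots,\alpha_n}(\mathrm{diag}(a_{11},\dots,a_{nn}))=\alpha_1a_{11}+\cdots+\alpha_na_{nn}$. *)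

(* Defs.v *)
From HB Require Import structures.
From mathcomp Require Export all_boot all_order all_algebra.
From mathcomp Require Export generic_quotient finmap.
From mathcomp.multinomials Require Export monalg.

Set Implicit Arguments.
Unset Strict Implicit.
Unset Printing Implicit Defensive.

Import GRing.Theory.

Local Open Scope ring_scope.
Local Open Scope quotient_scope.

(* Monomials in the noncommuting variables x_1, x_2, ...; the variable        *)
(* x_(i+1) has index i : nat.                                                 *)
Notation word := {fmonom nat}.
Notation nword := {w : {fmonom nat} | w != mone}.

(* Tr(MN) = Tr(NM): two nonempty monomials have the same formal trace iff     *)
(* they are cyclic rotations of each other.                                   *)
Definition cyc_rel : rel nword := fun u v =>
  [exists i : 'I_(size (val u)).+1, rot i (val u) == val v :> seq nat].

Lemma cyc_relP (u v : nword) :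
  reflect (exists i, rot i (val u) = val v :> seq nat) (cyc_rel u v).
Proof.
apply: (iffP existsP) => [[i /eqP e]|[i e]]; first by exists i.
case: (leqP i (size (val u))) => [le_i|lt_i].
  by exists (Ordinal (le_i : (i < _.+1)%N)); apply/eqP.
by exists ord0; rewrite /= rot0 -e rot_oversize // ltnW.
Qed.

Lemma cyc_rel_refl : reflexive cyc_rel.
Proof. by move=> u; apply/cyc_relP; exists 0%N; rewrite rot0. Qed.

Lemma cyc_rel_sym : symmetric cyc_rel.
Proof.
suff sub u v : cyc_rel u v -> cyc_rel v u by move=> u v; apply/idP/idP; apply: sub.
move=> /cyc_relP[i e]; apply/cyc_relP; rewrite -e.
by exists (size (rot i (val u)) - i)%N; rewrite -/(rotr i _) rotK.
Qed.

Lemma cyc_rel_trans : transitive cyc_rel.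
Proof.
move=> v u w /cyc_relP[i ei] /cyc_relP[j ej]; apply/cyc_relP; rewrite -ej -ei.
case: (leqP i (size (val u))) => [le_i|/ltnW lt_i]; last first.
  by exists j; rewrite (rot_oversize lt_i).
case: (leqP j (size (val u))) => [le_j|/ltnW lt_j]; last first.
  by exists i; rewrite [RHS]rot_oversize // size_rot.
by rewrite rot_add_mod //; eexists.
Qed.

Canonical cyc_equiv := EquivRel cyc_rel cyc_rel_refl cyc_rel_sym cyc_rel_trans.

Definition cword := {eq_quot cyc_equiv}.
HB.instance Definition _ := Choice.on cword.
HB.instance Definition _ := EqQuotient.on cword.

(* F[Tr(M) | M a nonempty monomial]: the polynomial ring over the cyclic      *)
(* words.                                                                     *)
Notation ptrace F := {malg F[{cmonom cword}]}.

(* F<X> (x) F[Tr(M)], as the free algebra on X with coefficients in the       *)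
(* commutative ring F[Tr(M)]; f@_w is the coefficient of the word w, and the  *)
(* pure trace term of f is f@_1.                                              *)
Notation tracepoly F := {malg {malg F[{cmonom cword}]}[{fmonom nat}]}.

Section FreeAlgebra.
Variable F : fieldType.

Definition var (i : nat) : tracepoly F := << fmu i >>.

Definition Tr_word (w : word) : ptrace F :=
  if insub w is Some u then << ucm (\pi_cword (u : nword)) >> else 0.

Lemma cyc_mulC (x y : nword) (u v : word) :
  val x = mmul u v -> val y = mmul v u -> \pi_cword x = \pi_cword y.
Proof.
move=> ex ey; apply/eqmodP/cyc_relP; exists (size u).
by rewrite ex ey !fmM rot_size_cat.
Qed.

Lemma Tr_wordC (u v : word) : Tr_word (mmul u v) = Tr_word (mmul v u).
Proof.
rewrite /Tr_word; case: insubP => [x _ ex|nx]; case: insubP => [y _ ey|ny].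
- by rewrite (cyc_mulC ex ey).
- by have := valP x; rewrite ex fmM_eq1 andbC -fmM_eq1 (negPf ny).
- by have := valP y; rewrite ey fmM_eq1 andbC -fmM_eq1 (negPf nx).
- by [].
Qed.

(* The F[Tr(M)]-linear extension, so that Tr(Tr(M)N) = Tr(M)Tr(N). The symbol *)
(* Tr(1) does not occur: here the empty word is sent to 0, and Tr is only     *)
(* relevant on elements without pure trace term.                              *)
Definition Tr (f : tracepoly F) : ptrace F :=
  \sum_(w <- msupp f) f@_w * Tr_word w.

Lemma TrC (f g : tracepoly F) : Tr (f * g) = Tr (g * f).
Proof.
have TrM (p q : tracepoly F) : Tr (p * q) = \sum_(u <- msupp p)
    \sum_(v <- msupp q) p@_u * q@_v * Tr_word (mmul u v).
  rewrite malgME -[Tr _]/(mmap idfun Tr_word _) raddf_sum; apply: eq_bigr => u _.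
  by rewrite raddf_sum; apply: eq_bigr => v _; exact: mmapU.
apply: etrans (TrM f g) _; apply: etrans (esym (TrM g f)).
rewrite exchange_big; apply: eq_bigr => u _; apply: eq_bigr => v _.
exact: (congr2 *%R (mulrC (f@_v) (g@_u)) (Tr_wordC v u)).
Qed.

Definition no_pure_term (f : tracepoly F) : Prop := f@_mone = 0.

Definition pure (f : tracepoly F) : Prop := exists p : ptrace F, f = p%:MP.

End FreeAlgebra.

(* Evaluation of trace polynomials in a C-algebra A with a trace              *)
(* tr : A -> C, where C is an F-algebra via iota.                             *)
Section Evaluation.
Variables (F : fieldType) (C : comNzRingType) (iota : F -> C).
Variables (A : lalgType C) (tr : A -> C) (a : nat -> A).

Definition eval_word (w : word) : A := \prod_(i <- w) a i.

Definition eval_cword (c : cword) : C := tr (eval_word (val (repr c))).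

Lemma eval_cwordE (trC : forall x y, tr (x * y) = tr (y * x)) (u : nword) :
  eval_cword (\pi_cword u) = tr (eval_word (val u)).
Proof.
rewrite /eval_cword; have /eqmodP : repr (\pi_cword u) = u %[mod cword].
  by rewrite reprK.
move: (repr _) => v /cyc_relP[i]; rewrite /eval_word => <-.
by rewrite -[in LHS](cat_take_drop i (val v)) /rot !big_cat trC.
Qed.

Definition eval_cmonom (m : {cmonom cword}) : C :=
  \prod_(c <- finsupp m) eval_cword c ^+ m c.

Definition eval_pure (p : ptrace F) : C := mmap iota eval_cmonom p.

Definition eval (f : tracepoly F) : A :=
  \sum_(w <- msupp f) eval_pure f@_w *: eval_word w.

End Evaluation.

Record trace (F : fieldType) (A : algType F) := Trace {
  trace_fun :> {scalar A};
  traceC : forall a b : A, trace_fun (a * b) = trace_fun (b * a)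
}.

Definition trace_identity (F : fieldType) (A : algType F) (t : trace A)
    (f : tracepoly F) : Prop :=
  forall a : nat -> A, eval idfun t a f = 0.

(* The endomorphism x_i |-> s i, Tr |-> Tr of the free algebra with trace.    *)
Definition subst (F : fieldType) (s : nat -> tracepoly F) (f : tracepoly F) :
    tracepoly F :=
  eval (fun c : F => c%:MP) (@Tr F) s f.

Record Ttr_ideal (F : fieldType) (I : tracepoly F -> Prop) : Prop := {
  Ttr_ideal0 : I 0;
  Ttr_idealD : forall f g, I f -> I g -> I (f + g);
  Ttr_idealMl : forall f g, I g -> I (f * g);
  Ttr_idealMr : forall f g, I f -> I (f * g);
  Ttr_ideal_subst : forall (s : nat -> tracepoly F) f,
    (forall i, no_pure_term (s i)) -> I f -> I (subst s f);
  Ttr_ideal_TrM : forall f (w : nword), I f -> I (Tr (f * << val w >>))%:MP;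
  Ttr_ideal_Tr : forall f, no_pure_term f -> I f -> I (Tr f)%:MP
}.

Definition Ttr_generated (F : fieldType) (S : tracepoly F -> Prop)
    (f : tracepoly F) : Prop :=
  forall I : tracepoly F -> Prop,
    Ttr_ideal I -> (forall g, S g -> I g) -> I f.

Lemma Ttr_generated_ideal (F : fieldType) (S : tracepoly F -> Prop) :
  Ttr_ideal (Ttr_generated S).
Proof.
split.
- by move=> I hI _; apply: Ttr_ideal0.
- by move=> f g hf hg I hI hS; apply: Ttr_idealD => //; [apply: hf|apply: hg].
- by move=> f g hg I hI hS; apply: Ttr_idealMl => //; apply: hg.
- by move=> f g hf I hI hS; apply: Ttr_idealMr => //; apply: hf.
- by move=> s f hs hf I hI hS; apply: Ttr_ideal_subst => //; apply: hf.
- by move=> f w hf I hI hS; apply: Ttr_ideal_TrM => //; apply: hf.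
- by move=> f f1 hf I hI hS; apply: Ttr_ideal_Tr => //; apply: hf.
Qed.

Definition commutator (F : fieldType) : tracepoly F :=
  var F 0 * var F 1 - var F 1 * var F 0.

(* (n+1) x (n+1) diagonal matrices.                                           *)
Section Diagonal.
Variables (F : fieldType) (n : nat).

Definition diag_pred : {pred 'M[F]_n.+1} := fun A => is_diag_mx A.

Lemma diag_pred_subalg : GRing.subalg_closed diag_pred.
Proof.
split=> [|c A B /diag_mxP[u ->] /diag_mxP[v ->]|A B /diag_mxP[u ->] /diag_mxP[v ->]].
- exact: scalar_mx_is_diag.
- by rewrite -linearP; apply: diag_mx_is_diag.
- by rewrite unfold_in /= [_ * _]mulmx_diag; apply: diag_mx_is_diag.
Qed.

HB.instance Definition _ := GRing.isSubalgClosed.Build F 'M[F]_n.+1 diag_pred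
  diag_pred_subalg.

Record diag_alg := DiagAlg { diag_val :> 'M[F]_n.+1; _ : diag_val \in diag_pred }.

HB.instance Definition _ := [isSub for diag_val].
HB.instance Definition _ := [Choice of diag_alg by <:].
HB.instance Definition _ := [SubChoice_isSubAlgebra of diag_alg by <:].

Variable alpha : 'I_n.+1 -> F.

Definition diag_tr_fun (A : diag_alg) : F := \sum_i alpha i * diag_val A i i.

Lemma diag_tr_scalar : scalar diag_tr_fun.
Proof.
move=> c A B; rewrite /diag_tr_fun mulr_sumr -big_split /=; apply: eq_bigr => i _.
by rewrite !mxE mulrDr mulrCA.
Qed.

HB.instance Definition _ := GRing.isLinear.Build F diag_alg F _ diag_tr_fun
  diag_tr_scalar.

Lemma diag_trC (A B : diag_alg) : diag_tr_fun (A * B) = diag_tr_fun (B * A).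
Proof.
congr diag_tr_fun; apply: val_inj; rewrite !rmorphM /=.
case: A B => [_ /= /diag_mxP[u ->]] [_ /= /diag_mxP[v ->]].
by rewrite ![_ * _]mulmx_diag; congr diag_mx; apply/rowP => i; rewrite !mxE mulrC.
Qed.

Definition diag_tr : trace diag_alg := Trace diag_trC.

End Diagonal.

(* (alpha_1, ..., alpha_n, 0)                                                 *)
Definition extend0 (F : fieldType) (n : nat) (alpha : 'I_n -> F) :
    'I_n.+1 -> F :=
  fun i => if unlift ord_max i is Some j then alpha j else 0.

(* Main.v *)
From HB Require Import structures.
Require Import Defs.

Set Implicit Arguments.
Unset Strict Implicit.
Unset Printing Implicit Defensive.

Import GRing.Theory.

Local Open Scope ring_scope.
Local Open Scope quotient_scope.

(** The weight of the last coordinate is zero, so no trace sees the last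
    entries of the matrices, and these can be varied freely while every trace
    keeps its value.

    Let [f] be a trace identity. Modulo the commutator the variables commute,
    so [f] is congruent to a sum of terms [p_u x^u], where [x^u] runs over
    commutative monomials and [p_u], the sum of the coefficients of all words
    that are rearrangements of [u], is a pure trace polynomial
    ([abelianized_coef], [ideal_of_abelianized_coef]). Fix an assignment [a] of
    diagonal matrices and replace the last entry of the matrix assigned to
    [x_i] by an arbitrary scalar [b_i]. The pure trace polynomials [p_u] do not
    change, so the last entry of the value of [f] is the ordinary polynomial
    [sum_u p_u(a) b^u] in the [b_i] ([diag_entry_eval_set_last]). It vanishes
    for all [b], and the field is infinite, hence every [p_u(a)] is zero
    ([sum_monomials_eq0]). So each [p_u] is itself a pure trace identity, and
    [f] is a consequence of these and of the commutator.

    Conversely, the trace identities of any algebra with trace form an ideal of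
    the required kind ([trace_identity_ideal]): evaluation in the algebra is a
    ring morphism that turns formal traces into traces and substitutions into
    changes of the assignment. Diagonal matrices commute, so the commutator is
    one of these identities. *)

(** * Evaluation of trace polynomials *)

Section EvalWord.
Variables (C : comNzRingType) (A : lalgType C) (a : nat -> A).

Lemma eval_wordM (u v : word) :
  eval_word a (mmul u v) = eval_word a u * eval_word a v.
Proof. by rewrite /eval_word fmM big_cat. Qed.

Lemma eval_word1 : eval_word a mone = 1.
Proof. by rewrite /eval_word fm1 big_nil. Qed.

Lemma eval_wordU (i : nat) : eval_word a (fmu i) = a i.
Proof. by rewrite /eval_word fmU big_seq1. Qed.

Lemma eval_word_mmorphism : mmorphism (eval_word a).
Proof. by split; [exact: eval_wordM | exact: eval_word1]. Qed.

HB.instance Definition _ :=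
  isMultiplicative.Build word A (eval_word a) eval_word_mmorphism.

End EvalWord.

Section Evaluation.
Variables (F : fieldType) (C : comNzRingType) (iota : {rmorphism F -> C}).
Variables (A : lalgType C) (tr : A -> C) (a : nat -> A).

Lemma eval_cmonomEw (d : {fset cword}) (m : {cmonom cword}) :
  (finsupp m `<=` d)%fset ->
  eval_cmonom tr a m = \prod_(c <- d) eval_cword tr a c ^+ m c.
Proof.
move=> le_d; rewrite /eval_cmonom; apply: big_fset_incl => // c _.
by rewrite -cmE_eq0 => /eqP ->.
Qed.

Lemma eval_cmonom_mmorphism : mmorphism (eval_cmonom tr a).
Proof.
split=> [m1 m2|]; last by rewrite /eval_cmonom mdom1 big_seq_fset0.
rewrite (eval_cmonomEw (d := finsupp m1 `|` finsupp m2)%fset); last first.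
  by rewrite mdomD.
rewrite (eval_cmonomEw (fsubsetUl _ (finsupp m2))).
rewrite (eval_cmonomEw (fsubsetUr (finsupp m1) _)) -big_split /=.
by apply: eq_bigr => c _; rewrite cmM exprD.
Qed.

HB.instance Definition _ :=
  isMultiplicative.Build {cmonom cword} C (eval_cmonom tr a)
    eval_cmonom_mmorphism.

Lemma eval_cmonomU (c : cword) : eval_cmonom tr a (ucm c) = eval_cword tr a c.
Proof. by rewrite /eval_cmonom mdomU big_seq_fset1 cmUU expr1. Qed.

HB.instance Definition _ :=
  GRing.RMorphism.copy (eval_pure iota tr a) (mmap iota (eval_cmonom tr a)).

(** Presents evaluation as an instance of the general morphism out of a monoid
    algebra, from which additivity and multiplicativity are inherited. *)
Lemma evalE (f : tracepoly F) :
  eval iota tr a f = mmap (in_alg A \o eval_pure iota tr a) (eval_word a) f.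
Proof. by apply: eq_bigr => w _; rewrite /= mulr_algl. Qed.

Lemma eval_is_additive : additive (eval iota tr a).
Proof. by move=> f g; rewrite !evalE raddfB. Qed.

HB.instance Definition _ :=
  GRing.isZmodMorphism.Build (tracepoly F) A (eval iota tr a) eval_is_additive.

Lemma evalU (p : ptrace F) (w : word) :
  eval iota tr a << p *g w >> = eval_pure iota tr a p *: eval_word a w.
Proof. by rewrite evalE mmapU /= mulr_algl. Qed.

End Evaluation.

(** The constant coefficient is a ring morphism, so one factor without pure
    trace term suffices. This is what keeps the formal trace, which sends the
    empty word to zero, faithful to the trace of the algebra when a
    substitution is made inside it. *)
Lemma no_pure_term_eval_word (F : fieldType) (s : nat -> tracepoly F) (w : word) :
  (forall i, no_pure_term (s i)) -> w != mone -> no_pure_term (eval_word s w).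
Proof.
move=> s1; rewrite fmP fm1 /eval_word; case: (val w) => // i w' _.
by rewrite big_cons /no_pure_term rmorphM /= s1 mul0r.
Qed.

Section TraceEvaluation.
Variables (F : fieldType) (A : algType F) (t : trace A) (a : nat -> A).

Lemma eval_is_multiplicative : multiplicative (eval idfun t a).
Proof.
have com (f : tracepoly F) (u v : word) :
    GRing.comm ((in_alg A \o eval_pure idfun t a) f@_u) (eval_word a v).
  by rewrite /GRing.comm /= mulr_algl mulr_algr.
have [fM f1] := commr_mmap_is_multiplicative com.
by split=> [f g|]; rewrite !evalE ?fM ?f1.
Qed.

HB.instance Definition _ :=
  GRing.isMonoidMorphism.Build (tracepoly F) A (eval idfun t a)
    (eval_is_multiplicative.2, eval_is_multiplicative.1).

Lemma evalC (p : ptrace F) : eval idfun t a p%:MP = (eval_pure idfun t a p)%:A.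
Proof. by rewrite evalU eval_word1. Qed.

Lemma eval_pure_Tr_word (w : word) : w != mone ->
  eval_pure idfun t a (Tr_word F w) = t (eval_word a w).
Proof.
move=> w_neq1; rewrite /Tr_word; case: insubP => [u _ <-|]; last by rewrite w_neq1.
rewrite /eval_pure mmapU mul1r eval_cmonomU eval_cwordE //; exact: traceC.
Qed.

(** The formal trace sends the empty word to zero, whereas the trace of the
    unit of [A] is arbitrary; the hypothesis excludes that word. *)
Lemma eval_pure_Tr (f : tracepoly F) : no_pure_term f ->
  eval_pure idfun t a (Tr f) = t (eval idfun t a f).
Proof.
move=> f1; rewrite /Tr /eval !raddf_sum; apply: eq_big_seq => w w_f /=.
rewrite rmorphM /= linearZ /= eval_pure_Tr_word //.
by apply: contraTneq w_f => ->; rewrite -mcoeff_eq0 f1.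
Qed.

Section Substitution.
Variables (s : nat -> tracepoly F).
Hypothesis s1 : forall i, no_pure_term (s i).

Let b i := eval idfun t a (s i).

Lemma eval_eval_word (w : word) :
  eval idfun t a (eval_word s w) = eval_word b w.
Proof. by rewrite /eval_word rmorph_prod. Qed.

Lemma eval_pure_subst (p : ptrace F) :
  eval_pure idfun t a (eval_pure (fun c : F => c%:MP) (@Tr F) s p) =
  eval_pure idfun t b p.
Proof.
rewrite {2}/eval_pure mmapE [RHS]/eval_pure raddf_sum; apply: eq_bigr => m _.
rewrite /= rmorphM /= [eval_pure _ _ _ _]mmapC; congr (_ * _).
rewrite /eval_cmonom rmorph_prod; apply: eq_bigr => c _.
rewrite rmorphXn /= /eval_cword eval_pure_Tr ?eval_eval_word //.
exact: no_pure_term_eval_word (valP (repr c)).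
Qed.

(** Evaluating after a substitution is evaluating at the values of the
    substituted elements: both sides are ring morphisms that agree on variables
    and commute with traces. *)
Lemma eval_subst (f : tracepoly F) :
  eval idfun t a (subst s f) = eval idfun t b f.
Proof.
rewrite /subst {2}/eval raddf_sum; apply: eq_bigr => w _.
by rewrite /= -mul_malgC rmorphM /= evalC eval_pure_subst eval_eval_word mulr_algl.
Qed.

End Substitution.
End TraceEvaluation.

(** * Trace identities form an ideal *)

Lemma trace_identity_ideal (F : fieldType) (A : algType F) (t : trace A) :
  Ttr_ideal (trace_identity t).
Proof.
have Tr_id f : no_pure_term f -> trace_identity t f -> trace_identity t (Tr f)%:MP.
  by move=> f1 f_id a; rewrite evalC eval_pure_Tr // f_id linear0 scale0r.
split=> [a|f g f_id g_id a|f g g_id a|f g f_id a|s f s1 f_id a|f w f_id|f f1 f_id].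
- by rewrite rmorph0.
- by rewrite rmorphD /= f_id g_id addr0.
- by rewrite rmorphM /= g_id mulr0.
- by rewrite rmorphM /= f_id mul0r.
- by rewrite eval_subst.
- apply: Tr_id => [|a]; last by rewrite rmorphM /= f_id mul0r.
  by rewrite /no_pure_term rmorphM /= mcoeffU (negPf (valP w)) mulr0.
- exact: Tr_id.
Qed.

Lemma commutator_trace_identity (F : fieldType) (A : algType F) (t : trace A) :
  (forall x y : A, x * y = y * x) -> trace_identity t (commutator F).
Proof.
move=> A_comm a; rewrite /commutator; move: (var F 0) (var F 1) => f g.
have evalM x y : eval idfun t a (x * y) = eval idfun t a x * eval idfun t a y.
  exact: rmorphM.
apply/eqP; rewrite rmorphB subr_eq0; apply/eqP.
exact: etrans (evalM f g) (etrans (A_comm _ _) (esym (evalM g f))).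
Qed.

(** * Reduction modulo the commutator *)

(** Products of elements that commute modulo a two-sided ideal do not depend,
    modulo the ideal, on the order of the factors. The ideal is a bare predicate
    on a ring because the ideals of trace polynomials are given that way. *)
Section CommutingProducts.
Variables (R : pzRingType) (I : R -> Prop).
Hypothesis I0 : I 0.
Hypothesis ID : forall a b, I a -> I b -> I (a + b).
Hypothesis IMl : forall a b, I b -> I (a * b).
Hypothesis IMr : forall a b, I a -> I (a * b).
Variables (T : eqType) (x : T -> R).
Hypothesis x_comm : forall i j, I (x i * x j - x j * x i).

Let trans b a c : I (a - b) -> I (b - c) -> I (a - c).
Proof. by move=> ab bc; rewrite -(subrKA b); exact: ID. Qed.

Lemma congr_comm_prod (i : T) (v : seq T) :
  I (x i * \prod_(j <- v) x j - (\prod_(j <- v) x j) * x i).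
Proof.
elim: v => [|j v IHv]; first by rewrite big_nil mulr1 mul1r subrr.
rewrite big_cons; apply: (@trans (x j * x i * \prod_(k <- v) x k)).
  by rewrite mulrA -mulrBl; exact: IMr.
by rewrite -!mulrA -mulrBr; exact: IMl.
Qed.

Lemma congr_prod_perm (u v : seq T) : perm_eq u v ->
  I (\prod_(i <- u) x i - \prod_(i <- v) x i).
Proof.
elim: u v => [|i u IHu] v uv.
  by move: uv; rewrite perm_sym => /perm_nilP ->; rewrite subrr.
have /path.splitPr v_i : i \in v by rewrite -(perm_mem uv) mem_head.
case: v_i uv => v1 v2.
rewrite -[i :: v2]cat1s perm_sym perm_catCA perm_cons perm_sym => /IHu.
rewrite big_cons !big_cat big_seq1 /= => u_v.
apply: (@trans (x i * (\prod_(k <- v1) x k * \prod_(k <- v2) x k))).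
  by rewrite -mulrBr; exact: IMl.
by rewrite !mulrA -mulrBl; apply: IMr; exact: congr_comm_prod.
Qed.

End CommutingProducts.

Lemma word_prod_var (F : fieldType) (w : word) :
  << w >> = \prod_(i <- w) var F i :> tracepoly F.
Proof.
case: w => l; elim: l => [|i l IHl] /=.
  by rewrite big_nil; congr << _ >>; apply/eqP; rewrite fmP fm1.
rewrite big_cons -IHl malgM_def fgmulUU mulr1; congr << _ >>.
by apply/eqP; rewrite fmP fmM fmU.
Qed.

Section CommutatorIdeal.
Variables (F : fieldType) (I : tracepoly F -> Prop).
Hypothesis idealI : Ttr_ideal I.
Hypothesis I_comm : I (commutator F).

Lemma ideal_sum (J : eqType) (r : seq J) (f : J -> tracepoly F) :
  {in r, forall j, I (f j)} -> I (\sum_(j <- r) f j).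
Proof.
move=> fI; rewrite big_seq; apply: (big_ind I) => //; first exact: Ttr_ideal0.
exact: Ttr_idealD.
Qed.

(** Any two variables commute modulo [I], by substituting them in the single
    generator [commutator]. *)
Lemma ideal_var_comm (i j : nat) : I (var F i * var F j - var F j * var F i).
Proof.
pose s (k : nat) := if k is 0%N then var F i else var F j.
have s1 k : no_pure_term (s k).
  by case: k => [|k]; rewrite /no_pure_term mcoeffU1 fm1_eq1.
suff <- : subst s (commutator F) = var F i * var F j - var F j * var F i.
  exact: Ttr_ideal_subst.
have substM k l : subst s (var F k * var F l) = s k * s l.
  rewrite /subst malgM_def fgmulUU mulr1 evalU rmorph1 scale1r.
  by rewrite eval_wordM !eval_wordU.
by rewrite /commutator -(substM 0%N 1%N) -(substM 1%N 0%N) /subst raddfB.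
Qed.

Lemma ideal_prod_perm (u v : seq nat) : perm_eq u v ->
  I (\prod_(i <- u) var F i - \prod_(i <- v) var F i).
Proof.
apply: congr_prod_perm; [exact: Ttr_ideal0|exact: Ttr_idealD|..].
- exact: Ttr_idealMl.
- by move=> f g; exact: Ttr_idealMr.
- exact: ideal_var_comm.
Qed.

(** The coefficient of the commutative monomial [u] in the image of [f] in the
    commutative polynomial ring over the pure trace polynomials. *)
Definition abelianized_coef (f : tracepoly F) (u : seq nat) : ptrace F :=
  \sum_(w <- msupp f | perm_eq w u) f@_w.

(** Modulo the commutator every word may be replaced by its sorted version;
    collecting the words with the same sorted version leaves a combination of
    the coefficients [abelianized_coef f u]. *)
Lemma ideal_of_abelianized_coef (f : tracepoly F) :
  (forall u, I (abelianized_coef f u)%:MP) -> I f.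
Proof.
move=> fI.
(* Sorting picks one representative in each class of rearrangements. *)
pose h (w : word) := sort leq w.
pose g := \sum_(w <- msupp f) (f@_w)%:MP * \prod_(i <- h w) var F i.
have eq_f : f = \sum_(w <- msupp f) (f@_w)%:MP * \prod_(i <- w) var F i.
  rewrite {1}[f]monalgE; apply: eq_bigr => w _; rewrite -word_prod_var.
  by rewrite malgM_def fgmulUU mulr1 mul1m.
suff : I (f - g) /\ I g by case=> fg /(Ttr_idealD idealI fg); rewrite subrK.
split.
  rewrite [X in X - _]eq_f -sumrB; apply: ideal_sum => w _.
  rewrite -mulrBr; apply: Ttr_idealMl => //; apply: ideal_prod_perm.
  by rewrite perm_sym perm_sort.
rewrite /g (partition_big_imfset _ h); apply: ideal_sum => u.
case/imfsetP=> w0 _ ->.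
rewrite (eq_bigr (fun w : word => (f@_w)%:MP * \prod_(i <- h w0) var F i)); last first.
  by move=> w /eqP ->.
rewrite -mulr_suml; apply: Ttr_idealMr => //; rewrite -raddf_sum.
congr (I _%:MP): (fI (w0 : seq nat)); apply: eq_bigl => w.
exact/(sameP (perm_sortP leq_total leq_trans anti_leq _ _))/eqP.
Qed.

End CommutatorIdeal.

(** * Independence of monomial functions *)

(** The exponent of the image of the monomial [w] under the Kronecker
    substitution [x_i |-> X ^ (N ^ i)]. *)
Definition kronecker_exp (N : nat) (w : seq nat) : nat := \sum_(i <- w) N ^ i.

(** In base [N] the digit of [kronecker_exp N w] at position [i] is the number
    of occurrences of [i] in [w]: the bound on the size prevents carries. *)
Lemma kronecker_exp_inj (N : nat) (u v : seq nat) :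
  (size u < N)%N -> (size v < N)%N ->
  kronecker_exp N u = kronecker_exp N v -> perm_eq u v.
Proof.
(* The contribution of the digits below position k. *)
pose S w k := (\sum_(i <- w) if i < k then N ^ i else 0)%N.
have S_lt w k : (size w < N)%N -> (S w k < N ^ k)%N.
  move=> w_lt; have N_gt0 : (0 < N)%N by exact: leq_ltn_trans w_lt.
  case: k => [|k].
    by rewrite /S big1_seq //= => i _; rewrite ltn0.
  apply: (@leq_ltn_trans (size w * N ^ k)%N); last first.
    by rewrite expnS ltn_pmul2r // expn_gt0 N_gt0.
  rewrite /S -sum1_size big_distrl /=; apply: leq_sum => i _; rewrite mul1n.
  by case: ifP => // i_lt; rewrite leq_pexp2l.
have digit w k : (size w < N)%N ->
    (count_mem k w = (kronecker_exp N w %/ N ^ k) %% N)%N.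
  move=> w_lt; have N_gt0 : (0 < N)%N by exact: leq_ltn_trans w_lt.
  have -> : (kronecker_exp N w =
      ((\sum_(i <- w) if k < i then N ^ (i - k.+1) else 0) * N + count_mem k w)
       * N ^ k + S w k)%N.
    rewrite mulnDl -mulnA -expnS big_distrl /= -sum1_count.
    rewrite [X in (_ + X * _ + _)%N]big_mkcond big_distrl /S.
    rewrite -!big_split; apply: eq_bigr => i _ /=.
    case: ltngtP => [lt_ik|lt_ki|->];
      rewrite ?mul0n ?add0n ?addn0 ?mul1n //.
    by rewrite -expnD subnK.
  rewrite divnMDl ?expn_gt0 ?N_gt0 // (divn_small (S_lt _ _ w_lt)) addn0.
  by rewrite modnMDl modn_small // (leq_ltn_trans (count_size _ _)).
move=> u_lt v_lt eq_uv; apply/allP => k _ /=.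
by apply/eqP; rewrite !digit ?eq_uv.
Qed.

Lemma poly_fun_eq0 (F : fieldType) (g : {poly F}) :
  [pchar F] =i pred0 -> (forall x, g.[x] = 0) -> g = 0.
Proof.
move=> charF g0; apply/eqP; apply: contraT => /max_poly_roots roots_lt.
have := roots_lt [seq i%:R | i <- iota 0 (size g)].
rewrite size_map size_iota ltnn.
apply; first by apply/allP => x _; apply/eqP; exact: g0.
have natr_inj : injective (fun i : nat => i%:R : F).
  have natr_eq0 := (pcharf0P F).1 charF.
  suff sub i j : i%:R = j%:R :> F -> (i <= j)%N.
    by move=> i j eq_ij; apply/anti_leq; rewrite !sub.
  move=> eq_ij; rewrite leqNgt; apply/negP => lt_ji.
  have := natr_eq0 (i - j)%N; rewrite natrB ?(ltnW lt_ji) // eq_ij subrr eqxx.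
  by rewrite subn_eq0 leqNgt lt_ji.
by rewrite map_inj_uniq ?iota_uniq.
Qed.

(** A polynomial in several variables that vanishes as a function has zero
    coefficients. The monomials are given as words, possibly with several
    rearrangements of the same one, whence the partial sums. Kronecker's
    substitution, with a base larger than all degrees, reduces the claim to one
    variable. *)
Lemma sum_monomials_eq0 (F : fieldType) (J : eqType) (r : seq J)
    (c : J -> F) (m : J -> seq nat) :
  [pchar F] =i pred0 ->
  (forall b : nat -> F, \sum_(j <- r) c j * \prod_(i <- m j) b i = 0) ->
  forall u, \sum_(j <- r | perm_eq (m j) u) c j = 0.
Proof.
move=> charF sum0 u.
pose N := (size u + \max_(j <- r) size (m j)).+1.
have N_gt j : j \in r -> (size (m j) < N)%N.
  move=> j_r; rewrite ltnS (leq_trans _ (leq_addl _ _)) //.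
  exact: leq_bigmax_seq.
pose g := \sum_(j <- r) c j *: 'X^(kronecker_exp N (m j)).
have g0 : g = 0.
  apply: poly_fun_eq0 => // x; rewrite -[RHS](sum0 (fun i => x ^+ (N ^ i))) /g.
  rewrite horner_sum; apply: eq_bigr => j _.
  by rewrite hornerZ hornerXn /kronecker_exp expr_sum.
rewrite -[RHS](coef0 _ (kronecker_exp N u)) -g0 coef_sum big_mkcond /=.
apply: eq_big_seq => j j_r; rewrite coefZ coefXn mulr_natr mulrb eq_sym.
congr (if _ then _ else _); apply/idP/eqP => [|/kronecker_exp_inj ->] //.
- by move=> mj_u; exact: perm_big.
- exact: N_gt.
- by rewrite ltnS leq_addr.
Qed.

(** * Diagonal matrices with a free last coordinate *)

Lemma diag_mulC (F : fieldType) (n : nat) (x y : diag_alg F n) : x * y = y * x.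
Proof.
apply: val_inj; rewrite !rmorphM /=.
case: x y => [_ /= /diag_mxP[u ->]] [_ /= /diag_mxP[v ->]].
by rewrite ![_ * _]mulmx_diag; congr diag_mx; apply/rowP => k; rewrite !mxE mulrC.
Qed.

Section FreeCoordinate.
Variables (F : fieldType) (n : nat) (alpha : 'I_n -> F).

Definition diag_entry (k : 'I_n.+1) (x : diag_alg F n) : F := diag_val x k k.

Lemma diag_entry_scalar (k : 'I_n.+1) : scalar (diag_entry k).
Proof. by move=> c x y; rewrite /diag_entry !mxE. Qed.

HB.instance Definition _ (k : 'I_n.+1) :=
  GRing.isLinear.Build F (diag_alg F n) F _ (diag_entry k) (diag_entry_scalar k).

Lemma diag_entry_multiplicative (k : 'I_n.+1) : multiplicative (diag_entry k).
Proof.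
split=> [x y|]; last by rewrite /diag_entry /= mxE eqxx.
have valM : diag_val (x * y) = diag_val x * diag_val y by exact: (rmorphM \val).
rewrite /diag_entry {}valM.
case: x y => [_ /= /diag_mxP[u ->]] [_ /= /diag_mxP[v ->]].
by rewrite [_ * _]mulmx_diag !mxE eqxx.
Qed.

HB.instance Definition _ (k : 'I_n.+1) :=
  GRing.isMultiplicative.Build (diag_alg F n) F (diag_entry k)
    (diag_entry_multiplicative k).

Definition set_last (x : diag_alg F n) (c : F) : diag_alg F n :=
  DiagAlg (diag_mx_is_diag
    (\row_k if k == ord_max then c else diag_entry k x)).

Lemma diag_entry_set_last (x : diag_alg F n) (c : F) (k : 'I_n.+1) :
  diag_entry k (set_last x c) = if k == ord_max then c else diag_entry k x.
Proof. by rewrite /diag_entry !mxE eqxx. Qed.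

Variables (a : nat -> diag_alg F n) (b : nat -> F).

Let a_b i := set_last (a i) (b i).

Lemma eval_pure_set_last (p : ptrace F) :
  eval_pure idfun (diag_tr (extend0 alpha)) a_b p =
  eval_pure idfun (diag_tr (extend0 alpha)) a p.
Proof.
rewrite /eval_pure; apply: eq_bigr => m _; congr (_ * _); apply: eq_bigr => c _.
congr (_ ^+ _); rewrite /eval_cword /= /diag_tr_fun; apply: eq_bigr => k _.
rewrite /extend0; case: unliftP => [j ->|_]; last by rewrite !mul0r.
congr (_ * _); rewrite -![diag_val _ _ _]/(diag_entry _ _) !rmorph_prod.
apply: eq_bigr => i _; rewrite /= diag_entry_set_last.
by rewrite eq_sym (negPf (neq_lift _ _)).
Qed.

Lemma diag_entry_eval_set_last (f : tracepoly F) :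
  diag_entry ord_max (eval idfun (diag_tr (extend0 alpha)) a_b f) =
  \sum_(w <- msupp f)
    eval_pure idfun (diag_tr (extend0 alpha)) a f@_w * \prod_(i <- w) b i.
Proof.
rewrite raddf_sum; apply: eq_bigr => w _; rewrite /= linearZ /= eval_pure_set_last.
congr (_ * _); rewrite rmorph_prod; apply: eq_bigr => i _.
by rewrite /= diag_entry_set_last eqxx.
Qed.

End FreeCoordinate.

(** Freeing the last entries turns the vanishing of [f] at [a] into the
    vanishing of a polynomial function of these entries, whose coefficients are
    the values at [a] of the pure trace polynomials in question. *)
Lemma trace_identity_abelianized_coef (F : fieldType)
    (charF : [pchar F] =i pred0) (n : nat) (alpha : 'I_n -> F)
    (f : tracepoly F) (u : seq nat) :
  trace_identity (diag_tr (extend0 alpha)) f ->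
  trace_identity (diag_tr (extend0 alpha)) (abelianized_coef f u)%:MP.
Proof.
move=> f_id a; rewrite evalC raddf_sum.
rewrite (sum_monomials_eq0 (m := fun w : word => w : seq nat)) ?scale0r // => b.
by rewrite /= -diag_entry_eval_set_last f_id raddf0.
Qed.

Theorem theorem7 (F : fieldType) (charF : [pchar F]%R =i pred0)
    (n : nat) (n_gt0 : (0 < n)%N) (alpha : 'I_n -> F) (f : tracepoly F) :
  trace_identity (diag_tr (extend0 alpha)) f <->
  Ttr_generated
    (fun g : tracepoly F =>
       g = commutator F \/
       (pure g /\ trace_identity (diag_tr (extend0 alpha)) g)) f.
Proof.
split=> [f_id I idealI I_gen | f_gen].
  apply: ideal_of_abelianized_coef => // [|u]; first by apply: I_gen; left.
  apply: I_gen; right; split; first by exists (abelianized_coef f u).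
  exact: trace_identity_abelianized_coef.
apply: f_gen => [|g [->|[_]] //]; first exact: trace_identity_ideal.
by apply: commutator_trace_identity; exact: diag_mulC.
Qed.
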